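(* Let $q$ be a prime power and let $n,d,\ell$ be positive integers with $\ell\ge n$. Then the polytope $Q(n,d,\ell)$ is integral, i.e., every $\widetilde{\mathbb{P}}\in Q(n,d,\ell)$ satisfies $\widetilde{\mathbb{P}}[S]\ge0$ for all $S\le\mathbb{F}_q^n$.
   Context: For $w\in\mathbb{F}_q^n$, $|w|$ is the Hamming weight (number of nonzero coordinates), and $[d-1]=\{1,\dots,d-1\}$. $S\le T$ means that $S$ is a linear subspace of $T$. $Q(n,d,\ell)$ (the feasible region of the pseudoprobability formulation of the partial Krawtchouk LP hierarchy) is the set of real vectors $(\widetilde{\mathbb{P}}[S])_{S\le\mathbb{F}_q^n}$, indexed by the linear subspaces of $\mathbb{F}_q^n$, such that (1) $\sum_{S\le\mathbb{F}_q^n}\widetilde{\mathbb{P}}[S]=1$; (2) $\widetilde{\mathbb{P}}[S]=0$ whenever there is $w\in S$ with $|w|\in[d-1]$; (3) $\sum_{T\le S\le U}|S|^r\,\widetilde{\mathbb{P}}[S]\ge0$ for all $T\le U\le\mathbb{F}_q^n$ and all integers $r$ with $n-\dim(U)\le r\le\ell$ and $\dim(T)\le\ell-r$; (4) $\sum_{U\le S\le\mathbb{F}_q^n}\widetilde{\mathbb{P}}[S]\ge0$ for all $U\le\mathbb{F}_q^n$. The polytope is called integral when all of its points have nonnegative coordinates (so that, by (1), they are probability distributions on subspaces). *)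

(* Defs.v *)
From HB Require Import structures.
From mathcomp Require Import all_boot all_order all_algebra all_field.
From mathcomp Require Import reals.

Set Implicit Arguments.
Unset Strict Implicit.
Unset Printing Implicit Defensive.

Import GRing.Theory Num.Theory.
Local Open Scope ring_scope.

(* {vspace vT} is a subtype of a matrix type, but the subtype instance is only
   visible after this import; it makes {vspace vT} finite over a finite field,
   so that one can sum over all subspaces. *)
Import VectorInternalTheory.
HB.instance Definition _ (F : finFieldType) (vT : vectType F) :=
  [Finite of {vspace vT} by <:].

Definition hamming_weight (F : finFieldType) (n : nat) (w : 'rV[F]_n) : nat :=
  #|[set i : 'I_n | w 0 i != 0]|.

(* A pseudoprobability vector, indexed by the subspaces of F_q^n, q = #|F|. *)
Definition pseudoprob (R : realType) (F : finFieldType) (n : nat) : Type :=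
  {ffun {vspace 'rV[F]_n} -> R}.

(* In the third constraint r ranges over nat: an integer r >= n - dim U is
   nonnegative, and no subtraction is truncated since dim U <= n and r <= l. *)
Definition krawtchouk_polytope (R : realType) (F : finFieldType)
    (n d l : nat) (P : pseudoprob R F n) : Prop :=
  [/\ \sum_(S : {vspace 'rV[F]_n}) P S = 1,
      forall S : {vspace 'rV[F]_n},
        (exists2 w : 'rV[F]_n, w \in S & (1 <= hamming_weight w <= d - 1)%N) ->
        P S = 0,
      forall (T U : {vspace 'rV[F]_n}) (r : nat),
        (T <= U)%VS -> (n - \dim U <= r <= l)%N -> (\dim T <= l - r)%N ->
        0 <= \sum_(S : {vspace 'rV[F]_n} | (T <= S <= U)%VS)
               #|S|%:R ^+ r * P S
    & forall U : {vspace 'rV[F]_n},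
        0 <= \sum_(S : {vspace 'rV[F]_n} | (U <= S)%VS) P S].

Definition integral_polytope (R : realType) (F : finFieldType) (n : nat)
    (Q : pseudoprob R F n -> Prop) : Prop :=
  forall P : pseudoprob R F n, Q P ->
  forall S : {vspace 'rV[F]_n}, 0 <= P S.

(* Main.v *)
(* Constraint (3) with T = U = S has the single term |S|^r P[S], and since
   l >= n the exponent r = n - dim S is admissible for every S. *)
Require Import Defs.
From mathcomp Require Import all_boot all_order all_algebra all_field.
From mathcomp Require Import reals.

Import Num.Theory.

Theorem proposition5p3 (R : realType) (F : finFieldType) (n d l : nat)
  (n_gt0 : (0 < n)%N) (d_gt0 : (0 < d)%N) (l_gt0 : (0 < l)%N)
  (le_nl : (n <= l)%N) :
  integral_polytope (@krawtchouk_polytope R F n d l).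
Proof.
move=> P [_ _ interval_ge0 _] S.
have dimS_le : (\dim S <= n)%N.
  by rewrite (leq_trans (dimvS (subvf S))) // dimvf /dim /= mul1n.
(* This is the least exponent allowed for [U = S], so it makes the bound [l - r] on [\dim T] as weak
   as possible. *)
have := interval_ge0 S S (n - \dim S)%N (subvv S).
rewrite leqnn (leq_trans (leq_subr _ _) le_nl) => /(_ isT).
(* Moving [n - \dim S] to the left turns this into exactly [n <= l]. *)
have -> : (\dim S <= l - (n - \dim S))%N.
  by rewrite leq_subRL ?(leq_trans (leq_subr _ _)) // subnK.
move=> /(_ isT).
(* By antisymmetry of inclusion the interval from [S] to [S] is a single point. *)
rewrite (big_pred1 S) => [|U]; last by rewrite /= -eqEsubv eq_sym.
(* The weight of [P S] is a power of [#|S|], positive since [S] contains 0, so it can be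
   cancelled. *)
rewrite pmulr_rge0 // exprn_gt0 // ltr0n.
by apply/card_gt0P; exists 0%R; rewrite mem0v.
Qed.
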